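(* A (Tychonoff) product of topological spaces is selectively sequentially pseudocompact if and only if each factor is selectively sequentially pseudocompact.
   Context: All topological spaces are assumed to be Tychonoff (in particular Hausdorff). The product is of an arbitrary family of topological spaces. A topological space $X$ is called selectively sequentially pseudocompact if for every family $\{U_n:n\in\mathbb{N}\}$ of non-empty open subsets of $X$ one can choose a point $x_n\in U_n$ for every $n\in\mathbb{N}$ in such a way that the sequence $\{x_n:n\in\mathbb{N}\}$ has a convergent subsequence (converging to some point of $X$). *)

(* Defs.v *)
From mathcomp Require Import all_boot all_order all_algebra.
From mathcomp Require Import all_classical all_reals all_analysis.

Set Implicit Arguments.
Unset Strict Implicit.
Unset Printing Implicit Defensive.

Local Open Scope classical_set_scope.

(* MathComp-Analysis defines [completely_regular_space] by uniform separation
   of points from closed sets; by [uniform_separatorP] this is separation by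
   continuous functions into the real interval [0, 1]. *)
Definition tychonoff_space (X : topologicalType) : Prop :=
  hausdorff_space X /\ completely_regular_space X.

(* Convergence is written with an explicit limit point because [cvg] would
   require a pointed space. *)
Definition has_convergent_subsequence (X : topologicalType) (x : nat -> X) :
    Prop :=
  exists2 f : nat -> nat, increasing_seq f & exists l : X, x \o f @ \oo --> l.

Definition selectively_sequentially_pseudocompact (X : topologicalType) :
    Prop :=
  forall U : nat -> set X,
    (forall n, open (U n)) -> (forall n, U n !=set0) ->
  exists2 x : nat -> X,
    (forall n, U n (x n)) & has_convergent_subsequence x.

(* Main.v *)
(* A nonempty open set of the product contains a nonempty open box constraining
   only finitely many coordinates, so a sequence of open sets constrains only
   countably many.  Factor by factor along these coordinates, one passes to
   finer and finer subsequences; the diagonal subsequence is eventually a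
   subsequence of each of them, hence works for all factors at once.  The
   remaining coordinates are kept constant.  Conversely, a selection
   from the cylinders over open sets of one factor projects to that factor. *)
Require Import Defs.
From mathcomp Require Import all_boot all_order all_algebra.
From mathcomp Require Import all_classical all_reals all_analysis.

Set Implicit Arguments.
Unset Strict Implicit.
Unset Printing Implicit Defensive.

Local Open Scope classical_set_scope.

Lemma increasing_seq_ge_id (f : nat -> nat) : increasing_seq f ->
  forall n, n <= f n.
Proof.
move=> /increasing_seqP f_lt; elim=> // n IHn.
exact: leq_ltn_trans IHn (f_lt n).
Qed.

Lemma increasing_seq_comp (f g : nat -> nat) :
  increasing_seq f -> increasing_seq g -> increasing_seq (f \o g).
Proof. by move=> f_incr g_incr m n /=; rewrite f_incr; exact: g_incr. Qed.

Lemma cvg_infty_ge_id (h : nat -> nat) :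
  (forall n, n <= h n) -> h @ \oo --> \oo.
Proof.
move=> h_ge A [N _ NA]; exists N => // n /= Nn.
by apply: NA => /=; exact: leq_trans Nn (h_ge n).
Qed.

(** Stage [k.+1] refines stage [k] so as to satisfy [P k], and from some index on the diagonal is a
    reindexing of each given stage. The second hypothesis lets [P k] ignore finitely many terms; the
    reindexing only has to tend to infinity. *)
Lemma diagonal_subsequence (P : nat -> (nat -> nat) -> Prop) :
  (forall k f, increasing_seq f ->
     exists2 g, increasing_seq g & P k (f \o g)) ->
  (forall k f h d, P k f -> h @ \oo --> \oo ->
     (\forall n \near \oo, d n = f (h n)) -> P k d) ->
  exists2 d, increasing_seq d & forall k, P k d.
Proof.
move=> P_refine P_sub.
have /choice[G GP] : forall kf : nat * (nat -> nat), exists g,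
    increasing_seq kf.2 -> increasing_seq g /\ P kf.1 (kf.2 \o g).
  move=> [k f]; have [f_incr|] := pselect (increasing_seq f).
    by have [g g_incr Pg] := P_refine k f f_incr; exists g.
  by exists id.
pose F := fix F k := if k is k'.+1 then F k' \o G (k', F k') else id.
have F_incr k : increasing_seq (F k).
  elim: k => [//|k IHk]; have [G_incr _] := GP (k, F k) IHk.
  exact: increasing_seq_comp.
have G_incr k : increasing_seq (G (k, F k)) by have [] := GP (k, F k) (F_incr k).
have F_sub k j : exists2 h, increasing_seq h & F (j + k) = F k \o h.
  elim: j => [|j [h h_incr Fh]]; first by exists id.
  exists (h \o G (j + k, F (j + k))); first exact: increasing_seq_comp.
  by rewrite addSn /= {1}Fh.
exists (fun n => F n n).
  (* [F n n < F n n.+1 <= F n (G (n, F n) n.+1)], and the last term is [F n.+1 n.+1]. *)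
  apply/increasing_seqP => n /=; rewrite ltEnat /=.
  apply: (@leq_trans (F n n.+1)); first by move/increasing_seqP: (F_incr n); apply.
  by have := F_incr n n.+1 (G (n, F n) n.+1);
    rewrite !leEnat increasing_seq_ge_id.
move=> k.
(* For [n <= k] the default [m = n] keeps [h] above the identity, hence tending to infinity. *)
have /choice[h hP] : forall n, exists m,
    n <= m /\ (k.+1 <= n -> F n n = F k.+1 m).
  move=> n; have [kn|nk] := leqP k.+1 n; last by exists n; split.
  have [h h_incr Fh] := F_sub k.+1 (n - k.+1).
  rewrite subnK // in Fh; exists (h n); split; first exact: increasing_seq_ge_id.
  by rewrite Fh.
apply: (P_sub k (F k.+1) h); first by have [] := GP (k, F k) (F_incr k).
  by apply: cvg_infty_ge_id => n; have [] := hP n.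
by exists k.+1 => // n /= kn; have [_ ->] := hP n.
Qed.

Section product.
Variables (I : Type) (X : I -> topologicalType).

Lemma nbhs_prod_topology (p : prod_topology X) (A : set (prod_topology X)) :
  nbhs p A -> exists V : forall i, set (X i),
    [/\ forall i, open (V i), forall i, V i (p i),
        finite_set [set i | V i <> setT] &
        [set x | forall i, V i (x i)] `<=` A].
Proof.
pose F : set_system (prod_topology X) :=
  [set B | exists V : forall i, set (X i),
    [/\ forall i, open (V i), forall i, V i (p i),
        finite_set [set i | V i <> setT] &
        [set x | forall i, V i (x i)] `<=` B]].
(* F is the filter generated by the boxes; it converges to p in each of the
   initial topologies whose supremum is the product topology. *)
suff : F --> p by move=> Fp /Fp.
have F_filter : Filter F.
  split.
  - exists (fun=> setT); split => //; first by move=> i; exact: openT.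
    by apply: sub_finite_set (@finite_set0 I) => i /=.
  - move=> B C [V [V_open Vp V_fin VB]] [W [W_open Wp W_fin WC]].
    exists (fun i => V i `&` W i); split => //.
    + by move=> i; exact: openI.
    + apply: (@sub_finite_set _ _ ([set i | V i <> setT] `|` [set i | W i <> setT])).
        move=> i /= VW; have [Vi|] := pselect (V i = setT); last by left.
        by right => Wi; apply: VW; rewrite Vi Wi setIT.
      by rewrite finite_setU.
    + by move=> x VWx; split; [apply: VB => i|apply: WC => i]; have [] := VWx i.
  - by move=> B C BC [V [V_open Vp V_fin VB]]; exists V; split => // x /VB/BC.
apply/cvg_sup => i B [_ [[W W_open <-] Wp WB]].
(* At [j = i] proof irrelevance reduces the transport to [W]; elsewhere there is no [e] and the set
   is [setT]. *)
exists (fun j => [set y | forall e : i = j, W (ecast k (X k) (esym e) y)]).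
split.
- move=> j; have [ij|ij] := pselect (i = j).
    case: j / ij; rewrite [X in open X](_ : _ = W); first exact: W_open.
    apply/seteqP; split => y /=; first by move/(_ erefl).
    by move=> Wy e; rewrite (Prop_irrelevance e erefl).
  rewrite [X in open X](_ : _ = setT); first exact: openT.
  by apply/seteqP; split => // y _ e; case: ij.
- by move=> j /= e; case: j / e.
- apply: sub_finite_set (finite_set1 i) => j /= Wj.
  apply: contrapT => ji; apply: Wj; apply/seteqP; split => // y _ e.
  by case: ji.
- by move=> x Wx; apply: WB; exact: (Wx i erefl).
Qed.

Lemma cvg_prod_topology (x : nat -> prod_topology X) (l : prod_topology X) :
  (forall i, (fun n => x n i) @ \oo --> l i) -> x @ \oo --> l.
Proof.
move=> xl; apply/cvg_sup => i B [_ [[W W_open <-] Wl WB]].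
by apply: filterS WB _; apply: xl; exact: open_nbhs_nbhs.
Qed.

Lemma selectively_sequentially_pseudocompact_factor (i : I) :
  (forall j, [set: X j] !=set0) ->
  selectively_sequentially_pseudocompact (prod_topology X) ->
  selectively_sequentially_pseudocompact (X i).
Proof.
move=> X_nonempty prodX U U_open U_nonempty.
have [p _] : exists p : forall j, X j, True.
  by exists (fun j => sval (cid (X_nonempty j))).
have proji_cont : continuous (fun x : prod_topology X => x i).
  exact: (@proj_continuous {classic I} X i).
have [||x xU [f f_incr [l xl]]] :=
    prodX (fun n => (fun x : prod_topology X => x i) @^-1` U n).
- move=> n; apply: open_comp => // y _; exact: proji_cont.
- move=> n; have [u Uu] := U_nonempty n.
  (* The fixed [p] supplies the coordinates other than [i]; [{classic I}] provides the equality test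
     for [dfwith]. *)
  exists (@dfwith {classic I} X p i u).
  by rewrite /= (@dfwithin {classic I} X).
exists (fun n => x n i) => //; exists f => //; exists (l i).
exact: (cvg_comp _ _ xl (proji_cont l)).
Qed.

Lemma selectively_sequentially_pseudocompact_prod :
  (forall i, selectively_sequentially_pseudocompact (X i)) ->
  selectively_sequentially_pseudocompact (prod_topology X).
Proof.
move=> facX U U_open U_nonempty.
have /choice[p pU] := U_nonempty.
have /choice[V VP] n : exists V : forall i, set (X i),
    [/\ forall i, open (V i), forall i, V i (p n i),
        finite_set [set i | V i <> setT] &
        [set x | forall i, V i (x i)] `<=` U n].
  by apply: nbhs_prod_topology; exact: open_nbhs_nbhs.
pose S := \bigcup_n [set i | V n i <> setT].
have S_countable : countable S.
  apply: bigcup_countable => // n _.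
  by have [_ _ V_fin _] := VP n; exact: finite_set_countable.
have [c c_inj] : exists c : I -> nat, {in S &, injective c}.
  by have /countable_injP := S_countable.
(* [z] selects for every [n], even off the range of [f], so that it still serves after passing to a
   subsequence. *)
pose Q i (f : nat -> nat) := exists2 z : nat -> X i,
  forall n, V n i (z n) & exists l : X i, z \o f @ \oo --> l.
have Q_refine i f : increasing_seq f ->
    exists2 g, increasing_seq g & Q i (f \o g).
  move=> f_incr.
  have [||y yV [g g_incr [l yl]]] := facX i (fun n => V (f n) i).
  - by move=> n; have [] := VP (f n).
  - by move=> n; exists (p (f n) i); have [] := VP (f n).
  exists g => //.
  (* Since [y n] lies in [V (f n) i], it becomes the value of [z] at [f n], unambiguously as [f] is
     injective; off the range of [f], [p m i] fills in. *)
  have /choice[z zP] m : exists z, V m i z /\ forall n, f n = m -> z = y n.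
    have [[n <-]|nfm] := pselect (exists n, f n = m).
      exists (y n); split => // n' /(increasing_seq_injective f_incr) <-.
      by [].
    exists (p m i); split; first by have [] := VP m.
    by move=> n fnm; case: nfm; exists n.
  exists z; first by move=> n; have [] := zP n.
  exists l; rewrite (_ : z \o _ = y \o g) //; apply/funext => n /=.
  by have [_ /(_ (g n) erefl)] := zP (f (g n)).
have Q_sub i f h d : Q i f -> h @ \oo --> \oo ->
    (\forall n \near \oo, d n = f (h n)) -> Q i d.
  move=> [z zV [l zl]] h_infty dE; exists z => //; exists l.
  apply: cvg_trans (cvg_comp _ _ h_infty zl).
  by apply: near_eq_cvg; apply: filterS dE => n /= ->.
(* Stage [k] treats the coordinate of [S] numbered [k] by [c]: there is at most one by injectivity,
   and with none the condition is vacuous. *)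
have [|k f h d Qf h_infty dE i Si ci|d d_incr Qd] :=
    @diagonal_subsequence (fun k f => forall i, S i -> c i = k -> Q i f).
- move=> k f f_incr.
  have [[i [Si ci]]|noi] := pselect (exists i, S i /\ c i = k).
    have [g g_incr Qg] := Q_refine i f f_incr; exists g => // j Sj cj.
    by have -> : j = i by apply: c_inj; rewrite ?inE // cj.
  by exists id => // i Si ci; case: noi; exists i.
- exact: Q_sub (Qf i Si ci) h_infty dE.
have Qd_all i : Q i d.
  have [Si|nSi] := pselect (S i); first exact: Qd Si erefl.
  (* Outside [S] every [V n i] is the whole factor, so a constant selection is admissible. *)
  exists (fun=> p 0 i); last by exists (p 0 i); exact: cvg_cst.
  move=> n; have -> // : V n i = setT.
  by apply: contrapT => Vn; apply: nSi; exists n.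
exists (fun n i => sval (cid2 (Qd_all i)) n).
  by move=> n; have [_ _ _ VU] := VP n; apply: VU => i; case: cid2.
have d_cvg i : exists l : X i, sval (cid2 (Qd_all i)) \o d @ \oo --> l.
  by case: cid2.
exists d => //; exists (fun i => sval (cid (d_cvg i))).
by apply: cvg_prod_topology => i; case: (cid (d_cvg i)).
Qed.

End product.

Theorem corollary4p5 (I : Type) (X : I -> topologicalType)
    (X_tychonoff : forall i, tychonoff_space (X i))
    (X_nonempty : forall i, [set: X i] !=set0) :
  selectively_sequentially_pseudocompact (prod_topology X) <->
  (forall i, selectively_sequentially_pseudocompact (X i)).
Proof.
split=> [prodX i|]; last exact: selectively_sequentially_pseudocompact_prod.
exact: selectively_sequentially_pseudocompact_factor.
Qed.
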